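(* Let $n\ge1$ and $c\ge1$ be integers. For $0\le k\le n$, $$i_c(n,k)=\binom{n+k-1}{k}+\sum_{j\ge1}(-1)^j\binom{n+k-cu_j-cj-1}{k-cu_j-cj}+\sum_{j\ge1}(-1)^j\binom{n+k-cu_j-1}{k-cu_j},$$ where $u_j=j(3j-1)/2$ is the $j$-th generalized pentagonal number.
   Context: For integers $n\ge1$, $c\ge1$, let $G_{c,n}$ be the set of colored permutations: words $\sigma=\sigma_1^{[c_1]}\cdots\sigma_n^{[c_n]}$ where $|\sigma|=\sigma_1\cdots\sigma_n$ is a permutation of $[n]$ and each color $c_i\in\{0,\dots,c-1\}$. For a permutation $\pi$ of $[n]$, $\mathrm{inv}(\pi)=|\{(i,j):i<j,\ \pi_i>\pi_j\}|$. Let $\mathrm{col}(\sigma)=c_1+\cdots+c_n$ and $\mathrm{inv}_c(\sigma)=\mathrm{inv}(|\sigma|)+\mathrm{col}(\sigma)+c\cdot|\{(i,j):1\le i<j\le n,\ \sigma_i<\sigma_j,\ c_j\ne0\}|$. Define $i_c(n,k)=|\{\sigma\in G_{c,n}:\mathrm{inv}_c(\sigma)=k\}|$. Binomial coefficients $\binom{m}{r}$ with $r<0$ are $0$ (so the sums are finite). *)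

(* Defs.v *)
From HB Require Import structures.
From mathcomp Require Import all_boot all_order all_fingroup all_algebra.
From mathcomp Require Import classical_sets fsbigop.

Set Implicit Arguments.
Unset Strict Implicit.
Unset Printing Implicit Defensive.

Import Order.TTheory GRing.Theory Num.Theory.

(* The colored permutation with s.1 the underlying permutation |sigma| (on
   {0, ..., n-1} instead of {1, ..., n}) and s.2 i the color of the i-th letter. *)
Definition colored_perm (c n : nat) : finType :=
  ({perm 'I_n} * {ffun 'I_n -> 'I_c})%type.

Definition inv (n : nat) (p : {perm 'I_n}) : nat :=
  #|[set ij : 'I_n * 'I_n | (ij.1 < ij.2) && (p ij.2 < p ij.1)]|.

Definition col (c n : nat) (s : colored_perm c n) : nat :=
  \sum_(i < n) s.2 i.

Definition invc (c n : nat) (s : colored_perm c n) : nat :=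
  inv s.1 + col s
  + c * #|[set ij : 'I_n * 'I_n |
            [&& ij.1 < ij.2, s.1 ij.1 < s.1 ij.2 & s.2 ij.2 != 0 :> nat]]|.

Definition ic (c n k : nat) : nat :=
  #|[set s : colored_perm c n | invc s == k]|.

(* The division is exact. *)
Definition pent (j : nat) : nat := (j * (3 * j - 1)) %/ 2.

(* The binomial coefficient m (m - 1) ... (m - r + 1) / r! for r >= 0, and 0 for
   r < 0; note that Negz m is - (m + 1). *)
Definition binz (m r : int) : int :=
  match r with
  | Negz _ => 0%R
  | Posz r =>
      match m with
      | Posz m => ('C(m, r))%:Z
      | Negz m => ((-1) ^+ r * ('C(m + r, r))%:Z)%R
      end
  end.

(* Main.v *)
(* Appending to a colored permutation of [n] a last letter with v smaller and n - v
   larger predecessors multiplies the weight, summed over the color of that letter, by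
   q^(n-v) (1 + (q + ... + q^(c-1)) q^(cv)), and summing over v gives
   (1 - q^(c(n+1))) / (1 - q).  Hence inv_c has generating function
   prod_(1 <= i <= n) (1 - q^(ci)) / (1 - q)^n.  Modulo q^(c(n+1)), hence for the
   coefficients of index k <= n, the numerator is given by Euler's pentagonal number
   theorem, in the finite form of Shanks, taken at q^c. *)
Require Import Defs.
From HB Require Import structures.
From mathcomp Require Import all_boot all_order all_fingroup all_algebra.
From mathcomp Require Import classical_sets fsbigop.
From mathcomp Require Import ring zify.

Set Implicit Arguments.
Unset Strict Implicit.
Unset Printing Implicit Defensive.

Import Order.TTheory GRing.Theory Num.Theory.
Local Open Scope ring_scope.

(** * Finite form of Euler's pentagonal number theorem *)

Section Pentagonal.
Variables (R : comNzRingType) (q : R).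

(* The term k = 0 is the Euler product, and q^(n+1) divides all the others. *)
Definition shanks (n : nat) : R :=
  \sum_(k < n.+1)
    (-1) ^+ k * (\prod_(k <= i < n) (1 - q ^+ i.+1)) * q ^+ (k * n + 'C(k.+1, 2)).

Lemma pent_double (j : nat) : (pent j * 2 = j * (3 * j - 1))%N.
Proof.
rewrite /pent divnK // dvdn2 oddM; case: j => // j.
by rewrite (_ : 3 * j.+1 - 1 = j.*2 + j.+2)%N; [rewrite oddD odd_double /=; case: odd | lia].
Qed.

Lemma bin2_double (k : nat) : ('C(k.+1, 2) * 2 = k.+1 * k)%N.
Proof. by rewrite bin2 -divn2 divnK // dvdn2 oddM /=; case: odd. Qed.

Lemma shanksS (n : nat) :
  shanks n.+1 = shanks n
    + (-1) ^+ n.+1 * (q ^+ (pent n.+1 + n.+1) + q ^+ pent n.+1).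
Proof.
pose P k := \prod_(k <= i < n) (1 - q ^+ i.+1).
pose A k := (-1) ^+ k * P k * q ^+ (k * n.+1 + 'C(k.+1, 2)).
pose B k := (-1) ^+ k * P k * q ^+ (k.+1 * n.+1 + 'C(k.+1, 2)).
(* The term [k = n.+1] has an empty product and is the first new power; in every other term the
   factor [1 - q ^+ n.+1] splits off [A k - B k]. *)
have -> : shanks n.+1 = \sum_(k < n.+1) (A k - B k)
    + (-1) ^+ n.+1 * q ^+ (pent n.+1 + n.+1).
  rewrite /shanks big_ord_recr /= big_geq // mulr1; congr (_ + _ * q ^+ _).
    apply: eq_bigr => k _; rewrite big_nat_recr /=; last by rewrite -ltnS.
    rewrite -/(P k) /A /B mulSn -addnA (exprD _ n.+1); ring.
  by have := pent_double n.+1; have := bin2_double n.+1; nia.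
(* A k.+1 minus the term k.+1 of shanks n is B k, so that shanks n.+1 - shanks n
   telescopes. *)
have step k : (k < n)%N ->
    A k.+1 - (-1) ^+ k.+1 * P k.+1 * q ^+ (k.+1 * n + 'C(k.+2, 2)) = B k.
  (* Here [P k = (1 - q ^+ k.+1) * P k.+1], and the subtracted term is [A k.+1] without a factor
     [q ^+ k.+1]. *)
  move=> lt_kn; rewrite /A /B /P (big_ltn (m := k)) // -!/(P _).
  have -> : (k.+1 * n.+1 + 'C(k.+2, 2) = k.+1 + (k.+1 * n + 'C(k.+2, 2)))%N by lia.
  have -> : (k.+1 * n.+1 + 'C(k.+1, 2) = k.+1 * n + 'C(k.+2, 2))%N.
    by have := bin2_double k.+1; have := bin2_double k; lia.
  by rewrite exprD (exprS _ k); ring.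
rewrite sumrB big_ord_recl big_ord_recr /= /shanks big_ord_recl /=.
rewrite -/(P 0%N) /A mul0n !add0n.
have -> : \sum_(i < n) (-1) ^+ bump 0 i * P (bump 0 i)
      * q ^+ (bump 0 i * n.+1 + 'C((bump 0 i).+1, 2)) =
    \sum_(i < n) ((-1) ^+ bump 0 i * P (bump 0 i)
      * q ^+ (bump 0 i * n + 'C((bump 0 i).+1, 2)) + B i).
  apply: eq_bigr => i _; rewrite -(step i (ltn_ord i)) /A /bump /=; ring.
(* The telescoping leaves only [- B n], the second new power. *)
have -> : B n = - ((-1) ^+ n.+1 * q ^+ pent n.+1).
  rewrite /B /P big_geq // mulr1 exprS mulN1r mulNr opprK; congr (_ * q ^+ _).
  by have := pent_double n.+1; have := bin2_double n; nia.
rewrite big_split /= /P; ring.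
Qed.

Lemma shanks_pent (n : nat) :
  shanks n = 1 + \sum_(1 <= j < n.+1) (-1) ^+ j * (q ^+ (pent j + j) + q ^+ pent j).
Proof.
elim: n => [|n IHn].
  by rewrite /shanks big_ord1 !big_geq // !mulr1 addr0.
by rewrite shanksS IHn [in RHS]big_nat_recr //= addrA.
Qed.

Lemma pentagonal_trunc (n : nat) :
  {r : R | \prod_(i < n) (1 - q ^+ i.+1) =
    1 + \sum_(1 <= j < n.+1) (-1) ^+ j * (q ^+ (pent j + j) + q ^+ pent j)
    + r * q ^+ n.+1}.
Proof.
(* Minus the terms of index [k.+1] of [shanks n], with [q ^+ n.+1] divided out; the predecessor is
   exact since the binomial is positive. *)
exists (- \sum_(k < n) (-1) ^+ k.+1 * (\prod_(k.+1 <= i < n) (1 - q ^+ i.+1))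
          * q ^+ (k * n + ('C(k.+2, 2)).-1)).
rewrite -shanks_pent /shanks big_ord_recl /= mul1r mul0n mulr1 big_mkord.
rewrite mulNr mulr_suml -addrA -[LHS]addr0; congr (_ + _).
apply/esym/eqP; rewrite subr_eq0; apply/eqP/eq_bigr => k _.
rewrite -!mulrA -exprD /bump /=; congr (_ * (_ * q ^+ _)).
have : (0 < 'C(k.+2, 2))%N by rewrite bin_gt0.
by rewrite add1n mulSn; lia.
Qed.

End Pentagonal.

(** * Coefficients of quotients by powers of 1 - X *)

Section DivisionByPowers.

(* Coefficient of 'X^m in (1 - X)^-n. *)
Definition multichoose (n m : nat) : nat := 'C(n + m - 1, m).

(** Pascal's rule: multiplying the series of index [n.+1] by 1 - X gives that of index [n]. *)
Lemma multichooseS n m :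
  multichoose n.+1 m.+1 = (multichoose n m.+1 + multichoose n.+1 m)%N.
Proof.
by rewrite /multichoose !addSn !subSS !subn0 !addnS subSS subn0 binS.
Qed.

Lemma multichoose_n0 n : multichoose n 0 = 1%N.
Proof. exact: bin0. Qed.

Lemma multichoose_0S m : multichoose 0 m.+1 = 0%N.
Proof. by rewrite /multichoose add0n subn1 bin_small. Qed.

(* Coefficient of 'X^k in the power series p / (1 - X)^n. *)
Definition div_coef (n k : nat) (p : {poly int}) : int :=
  \sum_(i < k.+1) p`_i * (multichoose n (k - i))%:Z.

Lemma div_coefMsubX n k p : div_coef n.+1 k ((1 - 'X) * p) = div_coef n k p.
Proof.
rewrite /div_coef; under eq_bigr => i _ do
  rewrite mulrBl mul1r coefB coefXM mulrBl.
rewrite sumrB [X in _ - X]big_ord_recl /= mul0r add0r.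
rewrite big_ord_recr [RHS]big_ord_recr /= subnn !multichoose_n0.
rewrite addrAC -sumrB; congr (_ + _); apply: eq_bigr => i _.
have lt_ik := ltn_ord i; rewrite /bump /= add1n subnS.
rewrite -mulrBr; congr (_ * _).
rewrite -(subnSK lt_ik) multichooseS PoszD /=; ring.
Qed.

(** Replaces division of power series: the factors [1 - 'X] cancel one at a time, and for exponent 0
    only the term [i = k] survives. *)
Lemma div_coefP n k (p r : {poly int}) :
  (1 - 'X) ^+ n * p = r -> p`_k = div_coef n k r.
Proof.
move=> <-; elim: n => [|n IHn]; last by rewrite exprS -mulrA div_coefMsubX.
rewrite mul1r /div_coef big_ord_recr /= subnn multichoose_n0 mulr1 big1 ?add0r //.
by move=> i _; rewrite -(subnSK (ltn_ord i)) multichoose_0S mulr0.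
Qed.

Lemma div_coefD n k p r : div_coef n k (p + r) = div_coef n k p + div_coef n k r.
Proof.
by rewrite /div_coef -big_split; apply: eq_bigr => i _; rewrite coefD mulrDl.
Qed.

Lemma div_coef_signM n k (j : nat) p :
  div_coef n k ((-1) ^+ j * p) = (-1) ^+ j * div_coef n k p.
Proof.
rewrite /div_coef mulr_sumr; apply: eq_bigr => i _.
by rewrite -polyCN -polyC_exp coefCM mulrA.
Qed.

Lemma div_coef_sum n k (I : Type) (s : seq I) (F : I -> {poly int}) :
  div_coef n k (\sum_(i <- s) F i) = \sum_(i <- s) div_coef n k (F i).
Proof.
apply: (big_morph _ (div_coefD n k)).
by rewrite /div_coef big1 // => i _; rewrite coef0 mul0r.
Qed.

Lemma div_coefMXn n k m p : (k < m)%N -> div_coef n k (p * 'X^m) = 0.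
Proof.
move=> lt_km; rewrite /div_coef big1 // => i _.
by rewrite coefMXn (leq_trans (ltn_ord i)) // mul0r.
Qed.

(** Only [i = m] contributes, and nothing does if [k < m], where the lower index is negative. As
    [n > 0], the truncated subtraction in [multichoose] agrees with the integer one. *)
Lemma div_coefXn n k m : (0 < n)%N ->
  div_coef n k 'X^m = binz (n%:Z + k%:Z - m%:Z - 1) (k%:Z - m%:Z).
Proof.
move=> n_gt0; have [le_mk | lt_km] := leqP m k.
  rewrite /div_coef (bigD1 (Ordinal (le_mk : (m < k.+1)%N))) //= coefXn eqxx mul1r.
  rewrite big1 ?addr0 => [|i /negPf]; last by rewrite -val_eqE /= coefXn => ->; rewrite mul0r.
  have -> : k%:Z - m%:Z = (k - m)%N by lia.
  by have -> : n%:Z + k%:Z - m%:Z - 1 = (n + (k - m) - 1)%N by lia.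
rewrite -[X in div_coef _ _ X]mul1r div_coefMXn //.
by have -> : k%:Z - m%:Z = Negz (m - k).-1 by lia.
Qed.

End DivisionByPowers.

(** * The generating function of inv_c *)

Section GeneratingFunction.
Variables (R : comNzRingType) (x : R) (c : nat).

(* The contribution, summed over its colors, of a letter preceded by a larger and b smaller ones. *)
Definition letter_weight (a b : nat) : R :=
  \sum_(d < c) x ^+ (a + d + c * (b * (d != 0 :> nat))).

Definition larger n (p : {perm 'I_n}) (j : 'I_n) : nat :=
  #|[set i : 'I_n | (i < j)%N && (p j < p i)%N]|.

Definition smaller n (p : {perm 'I_n}) (j : 'I_n) : nat :=
  #|[set i : 'I_n | (i < j)%N && (p i < p j)%N]|.

Lemma card_pair_set (T : finType) (P : T -> T -> bool) :
  #|[set u : T * T | P u.1 u.2]| = (\sum_j #|[set i | P i j]|)%N.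
Proof.
rewrite -sum1_card (eq_bigl (fun u => P u.1 u.2)); last by move=> u; rewrite !inE.
rewrite -(pair_big_dep xpredT (fun i j => P i j) (fun _ _ => 1%N)) /= (exchange_big_dep predT) //=.
by apply: eq_bigr => j _; rewrite -sum1_card; apply: eq_bigl => i; rewrite inE.
Qed.

(** Each pair is charged to its later letter, so a color affects only the summand of its own letter
    and the sum over colorings factors. *)
Lemma invcE n (s : colored_perm c n) :
  invc s = (\sum_j (larger s.1 j + s.2 j + c * (smaller s.1 j * (s.2 j != 0 :> nat))))%N.
Proof.
rewrite /invc /inv /col !big_split -big_distrr /=; congr (_ + _ + c * _)%N.
  exact: (card_pair_set (fun i j : 'I_n => (i < j)%N && (s.1 j < s.1 i)%N)).
rewrite (card_pair_set (fun i j : 'I_n => [&& (i < j)%N, (s.1 i < s.1 j)%N & s.2 j != 0 :> nat])).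
apply: eq_bigr => j _; case: eqP => _; rewrite ?muln0 ?muln1.
  by apply: eq_card0 => i; rewrite inE !andbF.
by apply: eq_card => i; rewrite !inE andbT.
Qed.

Lemma sum_invc n :
  \sum_(s : colored_perm c n) x ^+ invc s =
    \sum_(p : {perm 'I_n}) \prod_j letter_weight (larger p j) (smaller p j).
Proof.
rewrite -(pair_bigA _ (fun p f => x ^+ invc ((p, f) : colored_perm c n))) /=.
apply: eq_bigr => p _; rewrite /letter_weight bigA_distr_bigA /=.
by apply: eq_bigr => f _; rewrite invcE expr_sum.
Qed.

(** A permutation is encoded by its last value and the pattern of the other letters: the map is
    injective between sets of equal size. *)
Lemma sum_perm_lift_max n (F : {perm 'I_n.+1} -> R) :
  \sum_p F p = \sum_(v < n.+1) \sum_(s : {perm 'I_n}) F (lift_perm ord_max v s).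
Proof.
rewrite pair_bigA (reindex (fun u : 'I_n.+1 * {perm 'I_n} => lift_perm ord_max u.1 u.2)) //.
apply/onW_bij/inj_card_bij => [[v s] [w t] /= /permP eq_vw|]; last first.
  by rewrite card_prod card_ord !card_Sn factS.
have := eq_vw ord_max; rewrite !lift_perm_id => eq_v; rewrite {}eq_v in eq_vw *.
congr (_, _); apply/permP => i; apply: (@lift_inj _ w).
by rewrite -!(lift_perm_lift ord_max).
Qed.

Lemma ltn_lift n (v : 'I_n.+1) (i j : 'I_n) : (lift v i < lift v j)%N = (i < j)%N.
Proof. by rewrite /= /bump; lia. Qed.

Lemma max_ltn_lift n (j : 'I_n) : (@ord_max n < lift ord_max j)%N = false.
Proof. by rewrite lift_max ltnNge ltnW. Qed.

Lemma ltn_lift_max n (j : 'I_n) : (lift ord_max j < @ord_max n)%N.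
Proof. by rewrite lift_max. Qed.

Lemma card_lift n (P : pred 'I_n.+1) :
  #|[set i | P i]| = (P ord_max + #|[set i | P (lift ord_max i)]|)%N.
Proof.
rewrite -!sum1dep_card big_mkcond (bigD1_ord ord_max) //= -big_mkcond.
by case: (P ord_max).
Qed.

Section LiftPerm.
Variables (n : nat) (v : 'I_n.+1) (s : {perm 'I_n}).
Let t := lift_perm ord_max v s.

(** The last position precedes no other, and [lift v] preserves the order of values. *)
Lemma larger_lift j : larger t (lift ord_max j) = larger s j.
Proof.
rewrite /larger card_lift max_ltn_lift add0n.
by apply: eq_card => i; rewrite !inE !lift_perm_lift !ltn_lift.
Qed.

Lemma smaller_lift j : smaller t (lift ord_max j) = smaller s j.
Proof.
rewrite /smaller card_lift max_ltn_lift add0n.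
by apply: eq_card => i; rewrite !inE !lift_perm_lift !ltn_lift.
Qed.

Lemma smaller_lift_max : smaller t ord_max = v.
Proof.
rewrite /smaller card_lift ltnn add0n.
transitivity #|s @^-1: [set i : 'I_n | (i < v)%N]|.
  apply: eq_card => i.
  by rewrite !inE lift_perm_lift lift_perm_id ltn_lift_max /= /bump; lia.
rewrite card_preimset; last exact: perm_inj.
rewrite -sum1dep_card -(big_ord_widen _ (fun=> 1%N)); last by rewrite -ltnS.
by rewrite sum1_card card_ord.
Qed.

(** Of the [n] predecessors, [v] are smaller, and none is equal. *)
Lemma larger_lift_max : larger t ord_max = (n - v)%N.
Proof.
have <- : #|~: [set i | (t (lift ord_max i) < t ord_max)%N]| = (n - v)%N.
  rewrite cardsCs finset.setCK card_ord -smaller_lift_max /smaller card_lift ltnn add0n.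
  by congr (_ - _)%N; apply: eq_card => i; rewrite !inE ltn_lift_max.
rewrite /larger card_lift ltnn add0n; apply: eq_card => i.
rewrite !inE ltn_lift_max -leqNgt [RHS]leq_eqVlt.
by rewrite (inj_eq val_inj) (inj_eq perm_inj) (negPf (neq_lift _ _)).
Qed.

End LiftPerm.

Lemma letter_weightS a b : letter_weight a.+1 b = x * letter_weight a b.
Proof.
by rewrite /letter_weight mulr_sumr; apply: eq_bigr => d _; rewrite -exprS.
Qed.

(** Color 0 contributes 1; the other colors form a geometric progression starting at
    [x ^+ (c * b).+1]. *)
Lemma letter_weight0 b : (0 < c)%N ->
  (1 - x) * letter_weight 0 b = 1 - x + x ^+ (c * b).+1 - x ^+ (c * b.+1).
Proof.
rewrite /letter_weight; case: c => // m _; rewrite big_ord_recl /= !muln0 expr0.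
have -> : \sum_(d < m) x ^+ (0 + bump 0 d + m.+1 * (b * 1)) =
    x ^+ (m.+1 * b).+1 * \sum_(d < m) x ^+ d.
  rewrite mulr_sumr; apply: eq_bigr => d _; rewrite -exprD; congr (x ^+ _).
  by rewrite muln1 /bump; lia.
have -> : (m.+1 * b.+1 = (m.+1 * b).+1 + m)%N by lia.
rewrite exprD -[in X in _ - _ * X](subrK 1 (x ^+ m)) subrX1; ring.
Qed.

(** From [n] to [n.+1], the old terms are multiplied by [x] and the term [v = n.+1], with no larger
    predecessor, is added. *)
Lemma sum_letter_weight n :
  (1 - x) * \sum_(v < n.+1) letter_weight (n - v) v = 1 - x ^+ (c * n.+1).
Proof.
have [c0|c_gt0] := posnP c.
  rewrite big1 ?mulr0 ?c0 ?subrr // => v _.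
  by rewrite /letter_weight big1 // => -[d]; rewrite c0.
elim: n => [|n IHn]; first by rewrite big_ord1 letter_weight0 // muln0; ring.
rewrite big_ord_recr /= subnn mulrDr letter_weight0 //.
rewrite (eq_bigr (fun v : 'I_n.+1 => x * letter_weight (n - v) v)) => [|v _].
  by rewrite -mulr_sumr mulrCA IHn exprS; ring.
by rewrite subSn ?letter_weightS // -ltnS.
Qed.

(** The weight of the last letter depends only on its value [v], so the sum over [v] separates from
    the sum over patterns. *)
Lemma invc_gf n :
  (1 - x) ^+ n * \sum_(s : colored_perm c n) x ^+ invc s =
    \prod_(i < n) (1 - (x ^+ c) ^+ i.+1).
Proof.
rewrite sum_invc; elim: n => [|n IHn].
  rewrite mul1r big_ord0 (eq_bigr (fun=> 1)) => [|p _]; last by rewrite big_ord0.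
  by rewrite sumr_const card_Sn.
rewrite big_ord_recr /= -IHn -exprM -sum_letter_weight sum_perm_lift_max.
rewrite exprSr -!mulrA; congr (_ * _); rewrite mulrCA; congr (_ * _).
rewrite mulr_sumr; apply: eq_bigr => v _; rewrite mulr_suml.
apply: eq_bigr => s _; rewrite (bigD1_ord ord_max) //= mulrC.
rewrite larger_lift_max smaller_lift_max; congr (_ * _).
by apply: eq_bigr => j _; rewrite larger_lift smaller_lift.
Qed.

End GeneratingFunction.

(** * Extraction of the coefficient of index k *)

Lemma coef_invc_gf c n k :
  (\sum_(s : colored_perm c n) 'X^(invc s) : {poly int})`_k = (ic c n k)%:Z.
Proof.
rewrite coef_sum /ic -sum1dep_card -natz natr_sum [RHS]big_mkcond.
by apply: eq_bigr => s _; rewrite coefXn eq_sym; case: (_ == _).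
Qed.

Lemma fsbig_pos_nat (F : nat -> int) n :
  (forall j, (n < j)%N -> F j = 0) ->
  \sum_(j \in [set j : nat | (1 <= j)%N]%classic) F j = \sum_(1 <= j < n.+1) F j.
Proof.
move=> F0; rewrite (fsbigE (index_iota 1 n.+1)) ?iota_uniq //.
- rewrite [LHS]big_seq_cond [RHS]big_seq_cond; apply: eq_bigl => j.
  by rewrite andbT; apply: andb_idr; rewrite mem_index_iota => /andP[j_gt0 _]; apply: mem_set.
- by move=> j /=; rewrite mem_index_iota => /andP[].
- move=> j /= j_gt0; rewrite mem_index_iota j_gt0 /= -leqNgt; exact: F0.
Qed.

Lemma binz_neg m r : r < 0 -> binz m r = 0.
Proof. by case: r. Qed.

Local Open Scope classical_set_scope.

Theorem theorem3p4 (n c k : nat) (hn : (1 <= n)%N) (hc : (1 <= c)%N)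
    (hk : (k <= n)%N) :
  (ic c n k)%:Z =
    binz (n%:Z + k%:Z - 1) k%:Z
    + \sum_(j \in [set j : nat | (1 <= j)%N])
        (-1) ^+ j * binz (n%:Z + k%:Z - c%:Z * (pent j)%:Z - c%:Z * j%:Z - 1)
                         (k%:Z - c%:Z * (pent j)%:Z - c%:Z * j%:Z)
    + \sum_(j \in [set j : nat | (1 <= j)%N])
        (-1) ^+ j * binz (n%:Z + k%:Z - c%:Z * (pent j)%:Z - 1)
                         (k%:Z - c%:Z * (pent j)%:Z).
Proof.
(* For [j > n], [c * pent j >= j > k], so both infinite sums stop at [n]. *)
have binz0 m j : (n < j)%N -> binz m (k%:Z - c%:Z * (pent j)%:Z) = 0.
  move=> lt_nj; apply: binz_neg; have := pent_double j => pentE.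
  have pent_ge : (j <= pent j)%N by nia.
  have : (pent j <= c * pent j)%N by rewrite leq_pmull.
  by rewrite -PoszM; lia.
have binz0' m j : (n < j)%N -> binz m (k%:Z - c%:Z * (pent j)%:Z - c%:Z * j%:Z) = 0.
  move=> lt_nj; apply: binz_neg; have : (j <= c * j)%N by rewrite leq_pmull.
  by rewrite -!PoszM; lia.
rewrite !(@fsbig_pos_nat _ n); try by move=> j lt_nj; rewrite ?binz0 ?binz0' ?mulr0.
rewrite -coef_invc_gf (div_coefP k (invc_gf 'X c n)).
have [r ->] := pentagonal_trunc ('X^c : {poly int}) n.
(* The remainder is a multiple of ['X^(c * n.+1)], and [k < c * n.+1]. *)
rewrite !div_coefD div_coef_sum -exprM div_coefMXn ?addr0; last by nia.
rewrite -addrA -big_split /= -(expr0 'X) div_coefXn // !subr0; congr (_ + _).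
apply: eq_bigr => j _; rewrite div_coef_signM div_coefD -!exprM !div_coefXn // mulrDr.
by congr (_ * binz _ _ + _ * binz _ _); rewrite PoszM ?PoszD; ring.
Qed.
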